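(* Let $\varepsilon\in(0,1)$, let $n_1\neq n_2$ be integers with $n_1,n_2\ge 2$, and let $u_1,u_2$ be vertices of the complete graphs $G_1=K_{n_1}$ and $G_2=K_{n_2}$ respectively. Then $(G_1,u_1)$ and $(G_2,u_2)$ are distinguishable either by $S^{(1)}$ or by $S^{(2)}$.
   Context: Noisy voter model (NVM) with noise $\varepsilon\in(0,1)$ on a connected (locally finite, with at least two vertices) graph $G$: let $N_G(u)$ be the set of neighbors of $u$. At time $0$, $X_0(u)\sim\mathrm{Bern}(1/2)$ independently over all $u\in V(G)$. For every $t\ge 1$ and $u\in V(G)$, $$X_t(u)=\xi_t(u)Y_t(u)+(1-\xi_t(u))\sum_{v\in N_G(u)}I(\eta_t(u)=v)X_{t-1}(v),$$ where $\xi_t(u)\sim\mathrm{Bern}(\varepsilon)$, $Y_t(u)\sim\mathrm{Bern}(1/2)$, $\eta_t(u)$ is uniform on $N_G(u)$, and all the variables $\xi_t(u),Y_t(u),\eta_t(u)$ ($t\ge1$, $u\in V(G)$) and $X_0(u)$ ($u\in V(G)$) are independent. Write $X_t(G,u)=X_t(u)$. Distinguishability: let $(G_1,u_1),(G_2,u_2)$ be rooted graphs, both running the NVM with the same $\varepsilon$. They are distinguishable by a sequence $S=(S_t)_{t}$, where $S_t$ is a real-valued function of the observations up to time $t$ at a vertex, if there are sets $\mathcal S_1(t),\mathcal S_2(t)\subset\mathbb R$, disjoint for each $t$, such that $$\mathsf P\big[S_t(X_i(G_1,u_1),\,i\le t)\in\mathcal S_1(t),\ S_t(X_i(G_2,u_2),\,i\le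 t)\in\mathcal S_2(t)\big]\to1\quad (t\to\infty).$$ Repetition statistic: for $d\in\mathbb N$ and $t>d$, $S^{(d)}_t=\frac1{t-d}\sum_{i=1}^{t-d}I(X_i(u)=X_{i+d}(u))$, where $u$ is the observed vertex, and $S^{(d)}=(S^{(d)}_t)_t$. *)

(* Defs.v *)
From mathcomp Require Import all_boot all_order all_algebra finmap.
From mathcomp Require Import all_classical all_reals all_analysis.

Set Implicit Arguments.
Unset Strict Implicit.
Unset Printing Implicit Defensive.

Import Order.TTheory GRing.Theory Num.Theory.

Local Open Scope classical_set_scope.
Local Open Scope ring_scope.

(* Simple, locally finite, connected graphs with at least two vertices. *)
Record graph := Graph {
  vertex :> choiceType;
  neighbors : vertex -> {fset vertex};
  neighbors_sym : forall u v, (v \in neighbors u) = (u \in neighbors v);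
  neighbors_irr : forall u, u \notin neighbors u;
  neighbors_connected : forall u v, exists2 p : seq vertex,
    path (fun x y => y \in neighbors x) u p & last u p = v;
  neighbors_nontrivial : exists u v : vertex, u != v }.

Section complete_graph.
Variables (n : nat) (hn : (2 <= n)%N).

Definition complete_neighbors (u : 'I_n) : {fset 'I_n} :=
  [fset v : 'I_n | v != u]%fset.

Lemma in_complete_neighbors u v : (v \in complete_neighbors u) = (v != u).
Proof. by rewrite !inE. Qed.

Lemma complete_neighbors_sym u v :
  (v \in complete_neighbors u) = (u \in complete_neighbors v).
Proof. by rewrite !in_complete_neighbors eq_sym. Qed.

Lemma complete_neighbors_irr u : u \notin complete_neighbors u.
Proof. by rewrite in_complete_neighbors eqxx. Qed.

Lemma complete_neighbors_connected u v : exists2 p : seq 'I_n,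
  path (fun x y => y \in complete_neighbors x) u p & last u p = v.
Proof.
have [<-|uv] := eqVneq u v; first by exists [::].
by exists [:: v] => //=; rewrite in_complete_neighbors eq_sym uv.
Qed.

Lemma complete_neighbors_nontrivial : exists u v : 'I_n, u != v.
Proof. by exists (Ordinal (ltnW hn)), (Ordinal hn). Qed.

Definition complete_graph : graph :=
  Graph complete_neighbors_sym complete_neighbors_irr
    complete_neighbors_connected complete_neighbors_nontrivial.

End complete_graph.

(* Mutual independence of a family of classes of events: the product rule for
   every finite subfamily, the latter being given by an injective
   enumeration k of its indices. *)
Definition mutually_independent (R : realType) (d : measure_display)
    (Omega : measurableType d) (P : probability Omega R) (I : Type)
    (F : I -> set (set Omega)) : Prop :=
  forall (m : nat) (k : 'I_m -> I) (E : 'I_m -> set Omega),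
    injective k -> (forall j, F (k j) (E j)) ->
    P (\bigcap_(j in [set: 'I_m]) E j) = (\prod_(j < m) P (E j))%E.

Inductive nvm_index (V : Type) :=
| InitIdx of V
| NoiseIdx of nat & V
| FreshIdx of nat & V
| PickedIdx of nat & V.

(* The random variables driving the noisy voter model on G, realised on a
   probability space (Omega, P).  As xi_t, Y_t and eta_t exist for t >= 1 only,
   [noise t], [fresh t] and [picked t] stand for xi_(t+1), Y_(t+1) and
   eta_(t+1).  Since G is connected and locally finite, it is countable, and its
   vertex set carries the discrete sigma-algebra. *)
Record nvm (R : realType) (eps : R) (G : graph) (d : measure_display)
    (Omega : measurableType d) (P : probability Omega R) := NVM {
  init : G -> {RV P >-> bool};
  noise : nat -> G -> {RV P >-> bool};
  fresh : nat -> G -> {RV P >-> bool};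
  picked : nat -> G -> Omega -> G;
  picked_measurable : forall t u (B : set G), measurable (picked t u @^-1` B);
  init_law : forall u, distribution P (init u) =1 bernoulli_prob 2^-1;
  noise_law : forall t u, distribution P (noise t u) =1 bernoulli_prob eps;
  fresh_law : forall t u, distribution P (fresh t u) =1 bernoulli_prob 2^-1;
  picked_law : forall t u v, v \in neighbors u ->
    P (picked t u @^-1` [set v]) = (#|` neighbors u|%:R^-1)%:E;
  nvm_independent : mutually_independent P (fun i : nvm_index G =>
    match i with
    | InitIdx u => preimage_set_system setT (init u) setT
    | NoiseIdx t u => preimage_set_system setT (noise t u) setT
    | FreshIdx t u => preimage_set_system setT (fresh t u) setT
    | PickedIdx t u => preimage_set_system setT (picked t u) setT
    end) }.

(* The opinion X_t(u), valued in {0, 1}; booleans are coerced to nat. *)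
Fixpoint opinion (R : realType) (eps : R) (G : graph) (d : measure_display)
    (Omega : measurableType d) (P : probability Omega R) (M : nvm eps G P)
    (t : nat) (u : G) (w : Omega) : nat :=
  if t is s.+1 then
    (noise M s u w * fresh M s u w + (1 - noise M s u w) *
      \sum_(v <- neighbors u) (picked M s u w == v) * opinion M s v w)%N
  else init M u w.

(* A sequence of statistics: the one at time t is a function of the
   observations at times 0, ..., t. *)
Definition statistic (R : realType) := forall t : nat, ('I_t.+1 -> nat) -> R.

(* The law of each process does not depend on its realisation, and whether the
   joint probability tends to 1 does not depend on the coupling of the two
   processes; hence the quantification over all joint realisations. *)
Definition distinguishable (R : realType) (eps : R)
    (G1 : graph) (u1 : G1) (G2 : graph) (u2 : G2) (S : statistic R) : Prop :=
  exists S1 S2 : nat -> set R,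
    (forall t, S1 t `&` S2 t = set0) /\
    forall (d : measure_display) (Omega : measurableType d)
      (P : probability Omega R) (M1 : nvm eps G1 P) (M2 : nvm eps G2 P),
      P [set w | S1 t (S t (fun i => opinion M1 i u1 w)) /\
                 S2 t (S t (fun i => opinion M2 i u2 w))]
        @[t --> \oo] --> 1%E.

(* For t <= k the sum is empty and the value is 0. *)
Definition repetition_statistic (R : realType) (k : nat) : statistic R :=
  fun t x => (t - k)%:R^-1 *
    \sum_(1 <= i < (t - k).+1) (x (inord i) == x (inord (i + k)%N))%:R.

(* Main.v *)
(* The statistic S^(1) always distinguishes.  With spins s = 2 X - 1, N = n - 1
   and b = (1 - eps)^2, the correlation of two distinct vertices of K_n follows
   an affine recursion of ratio at most b, conditionally on any past; its fixed
   point is c = b (N - 1) / ((1 - b) N^2 + b (N - 1)).  Hence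
   s_i(u) s_(i+1)(u) has limiting mean (1 - eps) c and covariances decaying
   like b^k, so S^(1) concentrates around (1 + (1 - eps) c) / 2 by Chebyshev's
   inequality.  For N > 1, 1 / c - 1 is proportional to
   N^2 / (N - 1) = m + 2 + 1 / m with m = N - 1, which increases on the
   positive integers, and c = 0 for N = 1: distinct n give distinct limits. *)
From HB Require Import structures.
Require Import Defs.
From mathcomp Require Import all_boot all_order all_algebra finmap.
From mathcomp Require Import all_classical all_reals all_analysis.
From mathcomp Require Import measurable_realfun ring lra.

Set Implicit Arguments.
Unset Strict Implicit.
Unset Printing Implicit Defensive.

Import numFieldNormedType.Exports.
Import Order.TTheory GRing.Theory Num.Theory.

Local Open Scope ring_scope.

(** * Functions of finitely many coordinates of a family of variables *)

Section determined.
Context {I : eqType} {Omega V : Type} (Z : I -> Omega -> V).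

(** Stands in for measurability with respect to the sigma-algebra generated by the [Z i] with [i] in
    [s]; unlike the latter it is checked pointwise, without any measure theory. *)
Definition determined {T : Type} (s : seq I) (f : Omega -> T) : Prop :=
  forall w w', {in s, forall i, Z i w = Z i w'} -> f w = f w'.

Lemma determined_sub (T : Type) (s s' : seq I) (f : Omega -> T) :
  {subset s <= s'} -> determined s f -> determined s' f.
Proof. by move=> ss' df w w' h; apply: df => i /ss'; exact: h. Qed.

Lemma determined_comp (T U : Type) (s : seq I) (h : T -> U) (f : Omega -> T) :
  determined s f -> determined s (fun w => h (f w)).
Proof. by move=> df w w' e; rewrite (df w w'). Qed.

Lemma determined_comp2 (T1 T2 U : Type) (s : seq I) (h : T1 -> T2 -> U)
    (f : Omega -> T1) (g : Omega -> T2) :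
  determined s f -> determined s g -> determined s (fun w => h (f w) (g w)).
Proof. by move=> df dg w w' e; rewrite (df w w')// (dg w w'). Qed.

Definition finitary {T : Type} (f : Omega -> T) : Prop :=
  exists s, determined s f.

Lemma finitary_cst (T : Type) (x : T) : finitary (fun=> x).
Proof. by exists [::]. Qed.

Lemma finitary_comp (T U : Type) (h : T -> U) (f : Omega -> T) :
  finitary f -> finitary (fun w => h (f w)).
Proof. by move=> [s ds]; exists s; exact: determined_comp. Qed.

Lemma finitary_comp2 (T1 T2 U : Type) (h : T1 -> T2 -> U)
    (f : Omega -> T1) (g : Omega -> T2) :
  finitary f -> finitary g -> finitary (fun w => h (f w) (g w)).
Proof.
move=> [s ds] [s' ds']; exists (s ++ s'); apply: determined_comp2.
- by apply: determined_sub ds => i; rewrite mem_cat => ->.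
- by apply: determined_sub ds' => i; rewrite mem_cat => ->; rewrite orbT.
Qed.

Lemma finitary_sum (R : nmodType) (J : Type) (r : seq J) (p : pred J)
    (f : J -> Omega -> R) : (forall j, p j -> finitary (f j)) ->
  finitary (fun w => \sum_(j <- r | p j) f j w).
Proof.
move=> ff; elim: r => [|j r IH].
  by exists [::] => w w' _; rewrite !big_nil.
rewrite (_ : (fun w => _) = if p j
    then fun w => f j w + \sum_(i <- r | p i) f i w
    else fun w => \sum_(i <- r | p i) f i w); last first.
  by apply/funext => w; rewrite big_cons; case: ifP.
by case: ifPn => // pj; apply: (finitary_comp2 +%R (ff j pj) IH).
Qed.

End determined.

(** * Expectation of finitary functions of independent variables with finite range *)

Definition mean {R : realType} {d : measure_display} {Omega : measurableType d}
    (P : probability Omega R) (f : Omega -> R) : R :=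
  Rintegral P setT f.

Section independent_drivers.
Local Open Scope classical_set_scope.
Context {R : realType} {d : measure_display} {Omega : measurableType d}
  {P : probability Omega R} {I : choiceType} {V : finType}
  {Z : I -> Omega -> V}.
Hypothesis Z_measurable : forall i B, measurable (Z i @^-1` B).
Hypothesis Z_independent :
  mutually_independent P (fun i => preimage_set_system setT (Z i) setT).

Local Notation E := (mean P).

Lemma indep_seq (s : seq I) (B : I -> set V) : uniq s ->
  P (\bigcap_(i in [set` s]) (Z i @^-1` B i)) =
  (\prod_(i <- s) P (Z i @^-1` B i))%E.
Proof.
move=> us; rewrite big_tnth; have := @Z_independent (size s) (tnth (in_tuple s))
  (fun j => Z (tnth (in_tuple s) j) @^-1` B (tnth (in_tuple s) j)).
move=> <-; last 2 first.
- exact/tuple_uniqP.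
- by move=> j; exists (B (tnth (in_tuple s) j)) => //; rewrite setTI.
congr (P _); apply/seteqP; split => w /= h.
  by move=> j _; apply: h => /=; rewrite mem_tnth.
move=> i /= is_; have /(tnthP (in_tuple s))[j ->] := is_.
exact: h.
Qed.

Definition atom (s : seq I) (w0 : Omega) : set Omega :=
  \bigcap_(i in [set` s]) (Z i @^-1` [set Z i w0]).

Lemma measurable_atom (s : seq I) (w0 : Omega) : measurable (atom s w0).
Proof.
rewrite /atom bigcap_seq.
by elim/big_ind : _ => // A B mA mB; exact: measurableI.
Qed.

(** Since [V] is finite, only finitely many value tuples occur along [s]. The sum runs over the
    attained ones, so that each has a representative [w j] at which [f] can be evaluated. Finitary
    functions are thus simple, hence measurable and bounded. *)
Lemma determined_atoms (s : seq I) (f : Omega -> R) : determined Z s f ->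
  exists (J : finType) (w : J -> Omega),
    f = fun x => \sum_j f (w j) * \1_(atom s (w j)) x.
Proof.
move=> df; pose W w : (size s).-tuple V := [tuple of map (Z ^~ w) (in_tuple s)].
pose J := {x : (size s).-tuple V | `[< exists w, W w = x >]}.
pose rep (j : J) := projT1 (cid (asboolW (valP j))).
have repE j : W (rep j) = val j by exact: projT2 (cid (asboolW (valP j))).
exists J, rep; apply/funext => x.
have hx : `[< exists w, W w = W x >] by apply/asboolP; exists x.
have WP w w' : W w = W w' -> {in s, forall i, Z i w = Z i w'}.
  by move=> /(congr1 val) /eq_in_map.
rewrite (bigD1 (Sub (W x) hx)) //= big1 ?addr0 => [|j jx].
  have e := repE (Sub (W x) hx); rewrite SubK in e.
  rewrite indicE mem_set ?mulr1; first by apply: df; apply: WP; rewrite e.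
  by move=> i /= is_; apply/esym/(WP _ _ e).
rewrite indicE memNset ?mulr0// => h; case/negP: jx; apply/eqP.
apply: val_inj; rewrite SubK -repE; apply/val_inj/eq_in_map => i is_ /=.
by have /= := h i is_.
Qed.

Lemma finitary_measurable (f : Omega -> R) :
  finitary Z f -> measurable_fun setT f.
Proof.
move=> [s /determined_atoms[J [w ->]]].
apply: measurable_sum => j; apply: measurable_funM => //.
exact/measurable_indic/measurable_atom.
Qed.

Lemma finitary_integrable (f : Omega -> R) :
  finitary Z f -> P.-integrable setT (EFin \o f).
Proof.
move=> ff; apply: measurable_bounded_integrable => //.
- by rewrite -ge0_fin_numE ?measure_ge0//; exact: fin_num_measure.
- exact: finitary_measurable.
case: ff => s /determined_atoms[J [w fE]].
exists (\sum_j `|f (w j)|); split; first exact: num_real.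
move=> c hc x _ /=; apply: le_trans (ltW hc).
have /= -> := congr1 (@^~ x) fE.
apply: le_trans (ler_norm_sum _ _ _) _; apply: ler_sum => j _.
rewrite normrM ler_piMr// indicE.
by case: (_ \in _); rewrite ?normr1 ?normr0.
Qed.

Lemma finitary_measurable_pred (f : Omega -> bool) :
  finitary Z f -> measurable [set w | f w].
Proof.
move=> ff.
have := finitary_measurable (finitary_comp (fun b : bool => b%:R : R) ff).
move=> /(_ measurableT [set 1] (measurable_set1 _)); rewrite setTI.
congr measurable; apply/seteqP; split => w /=; last by move=> ->.
by case: (f w) => // /eqP; rewrite eq_sym oner_eq0.
Qed.

Lemma meanD (f g : Omega -> R) : finitary Z f -> finitary Z g ->
  E (fun w => f w + g w) = E f + E g.
Proof.
by move=> ff fg; apply: RintegralD => //; exact: finitary_integrable.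
Qed.

Lemma meanZ (c : R) (f : Omega -> R) : finitary Z f ->
  E (fun w => c * f w) = c * E f.
Proof. by move=> ff; apply: RintegralZl => //; exact: finitary_integrable. Qed.

Lemma mean_cst (c : R) : E (fun=> c) = c.
Proof.
rewrite /mean Rintegral_cst// -[RHS]mulr1; congr (_ * _).
exact: (congr1 fine (probability_setT P)). Qed.

Lemma mean_sum (J : Type) (r : seq J) (p : pred J) (f : J -> Omega -> R) :
  (forall j, p j -> finitary Z (f j)) ->
  E (fun w => \sum_(j <- r | p j) f j w) = \sum_(j <- r | p j) E (f j).
Proof.
move=> ff; elim: r => [|j r IH].
  rewrite big_nil -[RHS](mean_cst 0); congr E; apply/funext => w.
  by rewrite big_nil.
rewrite big_cons -IH; case: ifPn => pj.
  rewrite -meanD; [|exact: ff|exact: finitary_sum].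
  by congr E; apply/funext => w; rewrite big_cons pj.
by congr E; apply/funext => w; rewrite big_cons (negbTE pj).
Qed.

Lemma mean_le (f g : Omega -> R) : finitary Z f -> finitary Z g ->
  (forall w, f w <= g w) -> E f <= E g.
Proof.
by move=> ff fg fg'; apply: le_Rintegral => //; exact: finitary_integrable.
Qed.

Lemma mean_bound (C : R) (f : Omega -> R) : finitary Z f ->
  (forall w, `|f w| <= C) -> `|E f| <= C.
Proof.
move=> ff fC; have fCw w : - C <= f w <= C by rewrite -ler_norml.
rewrite ler_norml -{1}(mean_cst (- C)) -{2}(mean_cst C).
by apply/andP; split; apply: mean_le => //;
  (try exact: finitary_cst) => w; have /andP[] := fCw w.
Qed.

Lemma mean_indic (A : set Omega) : measurable A -> E \1_A = fine (P A).
Proof. by move=> mA; rewrite /mean /Rintegral integral_indic// setIT. Qed.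

(** By linearity it suffices to treat an atom of [s]: its intersection with the event on [Z i] is a
    cylinder over [i :: s], whose probability factors. *)
Lemma mean_indep (s : seq I) (f : Omega -> R) (i : I) (B : pred V) :
  determined Z s f -> i \notin s ->
  E (fun w => f w * (B (Z i w))%:R) = E f * fine (P (Z i @^-1` B)).
Proof.
(* The product rule [indep_seq] asks for a sequence without repetitions. *)
move=> df is_; have usf : determined Z (undup s) f.
  by apply: determined_sub df => j; rewrite mem_undup.
have us := undup_uniq s; have {is_}is_ : i \notin undup s by rewrite mem_undup.
move: (undup s) usf us is_ => {df}s df us is_.
have [J [w0 fE]] := determined_atoms df.
have BE w : (B (Z i w))%:R = \1_(Z i @^-1` B) w :> R.
  by rewrite indicE; congr (_%:R); rewrite mem_setE.
transitivity (E (fun w =>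
  \sum_j f (w0 j) * \1_(atom s (w0 j) `&` Z i @^-1` B) w)).
  congr E; apply/funext => w; rewrite BE {1}fE mulr_suml.
  by apply: eq_bigr => j _; rewrite indicI -mulrA.
have fin_atom j : finitary Z (\1_(atom s (w0 j)) : Omega -> R).
  exists s => w w' h; rewrite !indicE; congr (nat_of_bool _)%:R.
  by apply/idP/idP; rewrite !inE => hw k ks /=; rewrite -(hw k ks)/= h.
have finI j : finitary Z (\1_(atom s (w0 j) `&` Z i @^-1` B) : Omega -> R).
  have -> : \1_(atom s (w0 j) `&` Z i @^-1` B) =
    (fun w => \1_(atom s (w0 j)) w * (B (Z i w))%:R) :> (Omega -> R).
    by apply/funext => w; rewrite BE indicI.
  apply: finitary_comp2 => //; exists [:: i] => w w' h.
  by rewrite (h i) ?inE.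
have finZ (c : R) (g : Omega -> R) :
    finitary Z g -> finitary Z (fun w => c * g w).
  exact: finitary_comp.
rewrite mean_sum; last by move=> j _; exact/finZ/finI.
rewrite {2}fE mean_sum; last by move=> j _; exact/finZ/fin_atom.
rewrite mulr_suml; apply: eq_bigr => j _; rewrite !meanZ// -mulrA.
congr (_ * _); have mZ : measurable (Z i @^-1` B) by exact: Z_measurable.
rewrite !mean_indic//; [|exact: measurable_atom|
  by apply: measurableI => //; exact: measurable_atom].
(* One family of constraints describes both the atom, over [s], and its intersection with the event
   on [Z i], over [i :: s]. *)
pose C k : set V := if k == i then [set` B] else [set Z k (w0 j)].
have h1 : P (atom s (w0 j)) = (\prod_(k <- s) P (Z k @^-1` C k))%E.
  rewrite -indep_seq//; congr (P _); apply: eq_bigcapr => k /= ks.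
  by rewrite /C; case: eqP => // ki; rewrite -ki ks in is_.
have h2 : P (atom s (w0 j) `&` Z i @^-1` B) =
    (\prod_(k <- i :: s) P (Z k @^-1` C k))%E.
  rewrite -indep_seq/= ?is_//; congr (P _); apply/seteqP; split => w /=.
    move=> [h hB] k /=; rewrite inE => /orP[/eqP->|ks].
      by rewrite /C eqxx.
    by rewrite /C; case: eqP => [->//|_]; exact: h.
  move=> h; split; last by have := h i (mem_head _ _); rewrite /C eqxx.
  move=> k /= ks; have := h k; rewrite /= inE ks orbT => /(_ isT).
  by rewrite /C; case: eqP => // ki; rewrite -ki ks in is_.
rewrite h2 big_cons -h1 {1}/C eqxx muleC fineM// fin_num_measure//.
exact: measurable_atom.
Qed.

End independent_drivers.

HB.instance Definition _ (V : Type) := gen_eqMixin (nvm_index V).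
HB.instance Definition _ (V : Type) := gen_choiceMixin (nvm_index V).

(** * Sums over neighborhoods in the complete graph *)

Section complete_graph_sums.
Context {n : nat} {hn : (2 <= n)%N}.

Lemma perm_neighbors (u : 'I_n) :
  perm_eq (@neighbors (complete_graph hn) u) (enum [pred v : 'I_n | v != u]).
Proof.
apply: uniq_perm; [exact: fset_uniq|exact: enum_uniq|] => v.
by rewrite mem_enum; exact: in_complete_neighbors.
Qed.

Lemma big_neighbors (T : nmodType) (u : 'I_n) (F : 'I_n -> T) :
  \sum_(v <- @neighbors (complete_graph hn) u) F v = \sum_(v | v != u) F v.
Proof. by rewrite (perm_big _ (perm_neighbors u)) big_enum. Qed.

Lemma card_neq (u : 'I_n) : #|[pred v : 'I_n | v != u]| = n.-1.
Proof. by rewrite -[in RHS](card_ord n) -(cardC1 u). Qed.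

Lemma card_neighbors (u : 'I_n) :
  #|` @neighbors (complete_graph hn) u| = n.-1.
Proof. by rewrite (perm_size (perm_neighbors u)) -cardE card_neq. Qed.

End complete_graph_sums.

(* The fixed point of the recursion
   c |-> b / N^2 * (N - 1 + (N^2 - N + 1) * c), with b = (1 - eps)^2 and
   N = n - 1, satisfied by the correlation of two spins at the same time. *)
Definition pair_corr {R : realType} (eps : R) (n : nat) : R :=
  let b := (1 - eps) ^+ 2 in
  b * (n.-1%:R - 1) / ((1 - b) * n.-1%:R ^+ 2 + b * (n.-1%:R - 1)).

(** * The driving variables of the noisy voter model on the complete graph *)

Section noisy_voter_complete.
Local Open Scope classical_set_scope.
Context {R : realType} {eps : R} {n : nat} {hn : (2 <= n)%N}
  {d : measure_display} {Omega : measurableType d} {P : probability Omega R}.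
Variable M : nvm eps (complete_graph hn) P.
Hypotheses (eps0 : 0 < eps) (eps1 : eps < 1).

Local Notation E := (mean P).

(** The sum type gathers the Boolean variables and the picked vertices into a single family with one
    finite range, to which the results on independent variables apply. *)
Definition driver (i : nvm_index 'I_n) (w : Omega) : bool + 'I_n :=
  match i with
  | InitIdx u => inl (init M u w)
  | NoiseIdx t u => inl (noise M t u w)
  | FreshIdx t u => inl (fresh M t u w)
  | PickedIdx t u => inr (picked M t u w)
  end.

Lemma driver_measurable i (B : set (bool + 'I_n)) :
  measurable (driver i @^-1` B).
Proof.
have mb (X : {RV P >-> bool}) : measurable ((fun w => inl (X w)) @^-1` B).
  have := @measurable_funPT _ _ _ _ X measurableT (inl @^-1` B) I.
  by rewrite setTI.
case: i => [u|t u|t u|t u]; [exact: mb|exact: mb|exact: mb|].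
exact: (picked_measurable M t u (inr @^-1` B)).
Qed.

Lemma driver_independent :
  mutually_independent P (fun i => preimage_set_system setT (driver i) setT).
Proof.
move=> m k F ik kF; apply: (@nvm_independent _ _ _ _ _ _ M m k F ik) => j.
case: (kF j) => B _ <-.
case: (k j) => [u|t u|t u|t u]; [exists (inl @^-1` B)|exists (inl @^-1` B)|
  exists (inl @^-1` B)|exists (inr @^-1` B)] => //.
Qed.

Local Notation determined := (determined driver).
Local Notation finitary := (finitary driver).

Lemma bernoulli_set1 (p : R) (b : bool) : 0 <= p <= 1 ->
  fine (bernoulli_prob p [set b]) = if b then p else 1 - p.
Proof.
move=> p01; rewrite bernoulli_probE//= !indicE /unstable.onem.
case: b; [rewrite mem_set// memNset//|rewrite memNset// mem_set//].
- by rewrite mulr1 mulr0 addr0.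
- by rewrite mulr1 mulr0 add0r.
Qed.

Lemma mean_noise s (f : Omega -> R) t u b :
  determined s f -> NoiseIdx t u \notin s ->
  E (fun w => f w * (noise M t u w == b)%:R) =
  E f * (if b then eps else 1 - eps).
Proof.
move=> df is_.
have := mean_indep driver_measurable driver_independent
  (fun x => x == inl b) df is_.
rewrite /= => ->; congr (_ * _).
rewrite -(@bernoulli_set1 eps b) ?ltW// -(noise_law M t u [set b]).
congr (fine (P _)).
by apply/seteqP; split => w /=; [move=> /eqP[->]|move=> ->].
Qed.

Lemma mean_fresh s (f : Omega -> R) t u :
  determined s f -> FreshIdx t u \notin s ->
  E (fun w => f w * (fresh M t u w)%:R) = E f * 2^-1.
Proof.
move=> df is_.
have := mean_indep driver_measurable driver_independent
  (fun x => x == inl true) df is_.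
rewrite /= => h.
transitivity (E (fun w => f w * (fresh M t u w == true)%:R)).
  by congr E; apply/funext => w; rewrite eqb_id.
rewrite h; congr (_ * _).
rewrite -[RHS](@bernoulli_set1 _ true); last by lra.
rewrite -(fresh_law M t u [set true]); congr (fine (P _)).
by apply/seteqP; split => w /=; [move=> /eqP[->]|move=> ->].
Qed.

Lemma mean_picked s (f : Omega -> R) t u v :
  determined s f -> PickedIdx t u \notin s ->
  v != u -> E (fun w => f w * (picked M t u w == v)%:R) = E f / n.-1%:R.
Proof.
move=> df is_ vu.
have := mean_indep driver_measurable driver_independent
  (fun x => x == inr v) df is_.
rewrite /= => ->; congr (_ * _).
have := @picked_law _ _ _ _ _ _ M t u v.
rewrite card_neighbors in_complete_neighbors => /(_ vu) /(congr1 fine) /= <-.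
congr (fine (P _)).
by apply/seteqP; split => w /=; [move=> /eqP[->]|move=> ->].
Qed.

Lemma opinion_le1 t u w : (opinion M t u w <= 1)%N.
Proof.
elim: t u => [|t IH] u /=; first exact: leq_b1.
case: (noise M t u w) => /=.
  by rewrite mul1n subnn mul0n addn0 leq_b1.
rewrite mul0n subn0 mul1n add0n.
(* The law of [picked] makes the choice of [u] itself a null event but does not exclude it
   pointwise; the sum over the neighbors is then 0. *)
have [->|pu] := eqVneq (picked M t u w) u.
  rewrite big_neighbors big1// => v vu.
  by rewrite eq_sym (negbTE vu) mul0n.
rewrite big_neighbors (bigD1 (picked M t u w))//= eqxx mul1n.
rewrite big1 ?addr0 => [|v].
  exact: IH.
by move=> /andP[_ vu]; rewrite eq_sym (negbTE vu) mul0n.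
Qed.

(** * Spins, their filtration and the one-step recursions *)

Definition spin t u w : R := (opinion M t u w)%:R *+ 2 - 1.

Lemma spin_sqr t u w : spin t u w * spin t u w = 1.
Proof.
rewrite /spin; have := opinion_le1 t u w.
by case: (opinion M t u w) => [|[|//]] _; ring.
Qed.

Lemma spin_norm t u w : `|spin t u w| = 1.
Proof.
by apply/eqP; rewrite -sqr_norm_eq1 expr2 spin_sqr.
Qed.

Definition step_drivers t (u : 'I_n) : seq (nvm_index 'I_n) :=
  [:: NoiseIdx t u; FreshIdx t u; PickedIdx t u].

(** A finite list because the graph is finite; being determined by [past t] plays the role of
    measurability with respect to the natural filtration at time [t]. *)
Fixpoint past t : seq (nvm_index 'I_n) :=
  if t is s.+1 then past s ++ flatten [seq step_drivers s u | u <- enum 'I_n]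
  else [seq InitIdx u | u <- enum 'I_n].

(** The time at which a variable first acts, shifted by one since [noise t] stands for $\xi_{t+1}$.
    It separates [past t] from the drivers of the next step. *)
Definition stage (i : nvm_index 'I_n) : nat :=
  match i with
  | InitIdx _ => 0
  | NoiseIdx t _ | FreshIdx t _ | PickedIdx t _ => t.+1
  end.

Lemma past_stage t i : i \in past t -> (stage i <= t)%N.
Proof.
elim: t i => [|t IH] i /=; first by move=> /mapP[u _ ->].
rewrite mem_cat => /orP[/IH/leqW//|/flatten_mapP[u _]].
by rewrite !inE => /or3P[] /eqP ->.
Qed.

Lemma sub_past s t : (s <= t)%N -> {subset past s <= past t}.
Proof.
move=> /subnK <-; elim: (t - s)%N => // k IH i /IH.
by rewrite addSn /= mem_cat => ->.
Qed.

Lemma step_past t u : {subset step_drivers t u <= past t.+1}.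
Proof.
move=> i iu /=; rewrite mem_cat; apply/orP; right.
by apply/flatten_mapP; exists u => //; rewrite mem_enum.
Qed.

(** Keeping only the new drivers of [u], instead of all of [past t.+1], is what allows two distinct
    vertices to be averaged one after the other. *)
Lemma determined_opinion_step t u :
  (forall v, determined (past t) (opinion M t v)) ->
  determined (past t ++ step_drivers t u) (opinion M t.+1 u).
Proof.
move=> dt w w' h /=.
have hd i : i \in step_drivers t u -> driver i w = driver i w'.
  by move=> iu; apply: h; rewrite mem_cat iu orbT.
have [hN hF hP] : [/\ noise M t u w = noise M t u w',
    fresh M t u w = fresh M t u w' & picked M t u w = picked M t u w'].
  split.
  - by have /hd/= [] : NoiseIdx t u \in step_drivers t u
      by rewrite !inE eqxx ?orbT.
  - by have /hd/= [] : FreshIdx t u \in step_drivers t u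
      by rewrite !inE eqxx ?orbT.
  - by have /hd/= [] : PickedIdx t u \in step_drivers t u
      by rewrite !inE eqxx ?orbT.
rewrite hN hF hP; congr (_ + _ * _)%N; apply: eq_bigr => v _; congr (_ * _)%N.
by apply: dt => i it; apply: h; rewrite mem_cat it.
Qed.

Lemma determined_opinion t u : determined (past t) (opinion M t u).
Proof.
elim: t u => [|t IH] u.
  move=> w w' h /=; have /h/= [->//] : InitIdx u \in past 0.
  by apply/mapP; exists u => //; rewrite mem_enum.
apply: (determined_sub _ (@determined_opinion_step t u IH)) => i.
by rewrite mem_cat => /orP[/(sub_past (leqnSn t))//|/step_past].
Qed.

Lemma determined_spin t u : determined (past t) (spin t u).
Proof.
exact: (determined_comp (fun x : nat => x%:R *+ 2 - 1)
  (@determined_opinion t u)).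
Qed.

Lemma determined_spin_step t u :
  determined (past t ++ step_drivers t u) (spin t.+1 u).
Proof.
apply: (determined_comp (fun x : nat => x%:R *+ 2 - 1)).
exact/determined_opinion_step/determined_opinion.
Qed.

(** Each product ends with the new drivers, so that they can be integrated out from right to left by
    [mean_fresh], [mean_picked] and [mean_noise]. *)
Lemma opinion_stepE t u w : (opinion M t.+1 u w)%:R =
  (noise M t u w == true)%:R * (fresh M t u w)%:R +
  \sum_(v | v != u) (opinion M t v w)%:R *
    (noise M t u w == false)%:R * (picked M t u w == v)%:R :> R.
Proof.
rewrite /= big_neighbors natrD !natrM; congr (_ * _ + _).
  by case: (noise M t u w).
rewrite natr_sum mulr_sumr; apply: eq_bigr => v _; rewrite natrM.
by case: (noise M t u w) => /=; rewrite ?mulr0 ?mul0r ?mul1r ?mulr1// mulrC.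
Qed.

Lemma degree_neq0 : n.-1%:R != 0 :> R.
Proof. by rewrite pnatr_eq0 -lt0n -ltnS prednK// ltnW. Qed.

Lemma finitary_driver (i : nvm_index 'I_n) (T : Type) (h : bool + 'I_n -> T) :
  finitary (fun w => h (driver i w)).
Proof. by exists [:: i] => w w' e; rewrite (e i (mem_head _ _)). Qed.

Lemma finitary_opinion t u : finitary (opinion M t u).
Proof. by exists (past t); exact: determined_opinion. Qed.

Lemma finitary_spin t u : finitary (spin t u).
Proof. by exists (past t); exact: determined_spin. Qed.

Lemma mean_mul_spin t u (f : Omega -> R) : finitary f ->
  E (fun w => f w * spin t u w) =
  2 * E (fun w => f w * (opinion M t u w)%:R) - E f.
Proof.
move=> ff; have fX : finitary (fun w => f w * (opinion M t u w)%:R).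
  exact: (finitary_comp2 (fun (x : R) (k : nat) => x * k%:R) ff
    (@finitary_opinion t u)).
transitivity (E (fun w => 2 * (f w * (opinion M t u w)%:R) + -1 * f w)).
  by congr E; apply/funext => w; rewrite /spin; ring.
rewrite (meanD driver_measurable) ?(meanZ driver_measurable) ?mulN1r//.
- exact: finitary_comp fX.
- exact: finitary_comp ff.
Qed.

(* As [s] may contain the drivers of the other vertices at the same time step,
   this applies to the factors of a product of spins one after the other. *)
Lemma mean_spin_step s t u (f : Omega -> R) :
  determined s f -> {subset past t <= s} ->
  (forall i, i \in step_drivers t u -> i \notin s) ->
  E (fun w => f w * spin t.+1 u w) =
  (1 - eps) / n.-1%:R * \sum_(v | v != u) E (fun w => f w * spin t v w).
Proof.
move=> df ps hs.
have fin_f : finitary f by exists s.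
have [hN hF hP] : [/\ NoiseIdx t u \notin s, FreshIdx t u \notin s &
    PickedIdx t u \notin s].
  by split; apply: hs; rewrite !inE eqxx ?orbT.
have dX v : determined s (opinion M t v).
  exact: (determined_sub ps (@determined_opinion t v)).
have dfX v : determined s (fun w => f w * (opinion M t v w)%:R).
  exact: (determined_comp2 (fun (x : R) (k : nat) => x * k%:R) df (dX v)).
have d_noise (g : Omega -> R) b : determined s g ->
    determined (NoiseIdx t u :: s) (fun w => g w * (noise M t u w == b)%:R).
  move=> dg w w' h; have /= [->] := h (NoiseIdx t u) (mem_head _ _).
  by congr (_ * _); apply: dg => i is_; apply: h; rewrite inE is_ orbT.
have fin_main :
    finitary (fun w => f w * (noise M t u w == true)%:R * (fresh M t u w)%:R).
  apply: finitary_comp2; first by exists (NoiseIdx t u :: s); exact: d_noise.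
  exact: (@finitary_driver (FreshIdx t u) R
    (fun x => if x is inl b then b%:R else 0)).
have fin_copy v : finitary (fun w => f w * (opinion M t v w)%:R *
    (noise M t u w == false)%:R * (picked M t u w == v)%:R).
  apply: finitary_comp2.
    by exists (NoiseIdx t u :: s); exact: d_noise.
  exact: (@finitary_driver (PickedIdx t u) R
    (fun x => if x is inr y then (y == v)%:R else 0)).
have EX : E (fun w => f w * (opinion M t.+1 u w)%:R) =
    E f * (eps / 2) + (1 - eps) / n.-1%:R *
      \sum_(v | v != u) E (fun w => f w * (opinion M t v w)%:R).
  transitivity (E (fun w =>
    f w * (noise M t u w == true)%:R * (fresh M t u w)%:R +
    \sum_(v | v != u) f w * (opinion M t v w)%:R *
      (noise M t u w == false)%:R * (picked M t u w == v)%:R)).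
    congr E; apply/funext => w; rewrite opinion_stepE mulrDr mulrA mulr_sumr.
    by congr (_ + _); apply: eq_bigr => v _; rewrite !mulrA.
  rewrite (meanD driver_measurable)//; last exact: finitary_sum.
  rewrite (mean_sum driver_measurable)//.
  rewrite (@mean_fresh (NoiseIdx t u :: s)); [|exact: d_noise|]; last first.
    by rewrite inE negb_or hF andbT; apply/eqP.
  rewrite (@mean_noise s)// mulrA; congr (_ + _).
  rewrite mulr_sumr; apply: eq_bigr => v vu.
  rewrite (@mean_picked (NoiseIdx t u :: s))//; [|exact: d_noise|]; last first.
    by rewrite inE negb_or hP andbT; apply/eqP.
  by rewrite (@mean_noise s)// -mulrA mulrC.
have card_sum : \sum_(v | v != u) E f = n.-1%:R * E f.
  by rewrite sumr_const card_neq mulr_natl.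
(* In terms of spins the multiples of [E f] cancel: [eps] from the noise and [1 - eps] from the
   copies balance the [- E f] of the left-hand side. *)
rewrite mean_mul_spin// EX (eq_bigr _ (fun v _ => mean_mul_spin t v fin_f)).
rewrite big_split/= -mulr_sumr sumrN card_sum.
by field; exact: degree_neq0.
Qed.

Lemma step_drivers_fresh t u i : i \in step_drivers t u -> i \notin past t.
Proof.
move=> iu; apply/negP => /past_stage.
by move: iu; rewrite !inE => /or3P[] /eqP -> /=; rewrite ltnn.
Qed.

Lemma step_drivers_disjoint t u v i : u != v ->
  i \in step_drivers t u -> i \notin step_drivers t v.
Proof.
move=> uv iu; apply/negP; move: iu; rewrite !inE.
by move=> /or3P[] /eqP -> /or3P[] /eqP // [] /eqP; rewrite (negbTE uv).
Qed.

(** Distinct vertices have disjoint new drivers. The spin of [v] is first absorbed into the test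
    function while [u] is averaged; then [v] is averaged over drivers outside [past t]. Terms with
    [x = y] occur when both vertices copy the same one. *)
Lemma mean_spin_pair_step t u v (f : Omega -> R) :
  determined (past t) f -> u != v ->
  E (fun w => f w * (spin t.+1 u w * spin t.+1 v w)) =
  ((1 - eps) / n.-1%:R) ^+ 2 * \sum_(x | x != u) \sum_(y | y != v)
    E (fun w => f w * (spin t x w * spin t y w)).
Proof.
move=> df uv.
transitivity (E (fun w => (f w * spin t.+1 v w) * spin t.+1 u w)).
  by congr E; apply/funext => w; ring.
rewrite (@mean_spin_step (past t ++ step_drivers t v)).
- rewrite expr2 -[RHS]mulrA; congr (_ * _); rewrite mulr_sumr.
  apply: eq_bigr => x xu.
  transitivity (E (fun w => (f w * spin t x w) * spin t.+1 v w)).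
    by congr E; apply/funext => w; ring.
  rewrite (@mean_spin_step (past t))//; last exact: step_drivers_fresh.
    by congr (_ * _); apply: eq_bigr => y yv; congr E; apply/funext => w; ring.
  exact: (determined_comp2 *%R df (@determined_spin t x)).
- apply: (determined_comp2 *%R _ (@determined_spin_step t v)).
  by apply: (determined_sub _ df) => i it; rewrite mem_cat it.
- by move=> i it; rewrite mem_cat it.
- move=> i iu; rewrite mem_cat negb_or (step_drivers_fresh iu).
  exact: step_drivers_disjoint iu.
Qed.

(** * The limiting pair correlation and the rate of convergence to it *)

Local Notation b := ((1 - eps) ^+ 2).
Local Notation N := (n.-1%:R : R).
Local Notation c := (pair_corr eps n).

Lemma degree_ge1 : 1 <= N.
Proof. by rewrite ler1n -ltnS prednK// ltnW. Qed.

Lemma sqr_copy_gt0 : 0 < b. Proof. by rewrite exprn_gt0// subr_gt0. Qed.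

Lemma sqr_copy_lt1 : b < 1.
Proof. by rewrite expr_lt1// ?subr_ge0 ?ltW// gtrBl. Qed.

Lemma pair_corr_den_gt0 : 0 < (1 - b) * N ^+ 2 + b * (N - 1).
Proof.
apply: ltr_wpDr.
  by rewrite mulr_ge0 ?subr_ge0 ?degree_ge1// ltW ?sqr_copy_gt0.
rewrite mulr_gt0 ?subr_gt0 ?sqr_copy_lt1// exprn_gt0//.
exact: lt_le_trans ltr01 degree_ge1.
Qed.

Lemma pair_corr_ge0 : 0 <= c.
Proof.
rewrite divr_ge0 ?(ltW pair_corr_den_gt0)// mulr_ge0 ?subr_ge0 ?degree_ge1//.
exact: ltW sqr_copy_gt0.
Qed.

Lemma pair_corr_le1 : c <= 1.
Proof.
rewrite ler_pdivrMr ?pair_corr_den_gt0// mul1r lerDr mulr_ge0 ?sqr_ge0//.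
by rewrite subr_ge0 ltW ?sqr_copy_lt1.
Qed.

Lemma sum_neq_eq (x v : 'I_n) :
  \sum_(y | y != v) (x == y)%:R = (x != v)%:R :> R.
Proof.
have [->|xv] /= := eqVneq x v.
  by rewrite big1// => y yv; rewrite eq_sym (negbTE yv).
rewrite (bigD1 x)//= eqxx big1 ?addr0// => y /andP[_ yx].
by rewrite eq_sym (negbTE yx).
Qed.

(** Among the $N^2$ pairs, the diagonal ones correspond to the $n - 2 = N - 1$ vertices other than
    [u] and [v]; each contributes an excess [1 - z]. *)
Lemma sum_neq_pairs (u v : 'I_n) (z : R) : u != v ->
  \sum_(x | x != u) \sum_(y | y != v) (if x == y then 1 else z) =
  N ^+ 2 * z + (N - 1) * (1 - z).
Proof.
move=> uv.
have inner x : \sum_(y | y != v) (if x == y then 1 else z) =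
    N * z + (1 - z) * (1 - (v == x)%:R).
  rewrite (eq_bigr (fun y => z + (1 - z) * (x == y)%:R)) => [|y _]; last first.
    by case: (x == y) => /=; ring.
  rewrite big_split/= -mulr_sumr sum_neq_eq sumr_const card_neq mulr_natl.
  by congr (_ + _ * _); rewrite eq_sym; case: (v == x); rewrite ?subrr ?subr0.
rewrite (eq_bigr _ (fun x _ => inner x)) big_split/= sumr_const.
rewrite -mulr_sumr big_split/= sumrN sum_neq_eq eq_sym uv.
rewrite !sumr_const !card_neq -[_ *+ _]mulr_natl.
by rewrite /=; ring.
Qed.

Lemma pair_corr_fixpoint (u v : 'I_n) : u != v ->
  c = ((1 - eps) / N) ^+ 2 * \sum_(x | x != u) \sum_(y | y != v)
    (if x == y then 1 else c).
Proof.
move=> uv; rewrite sum_neq_pairs// /pair_corr/=.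
have D0 := lt0r_neq0 pair_corr_den_gt0; have N0 := degree_neq0.
by field; rewrite N0 D0.
Qed.

(** The arbitrary [f] makes this a bound conditional on the past. Subtract the fixed-point identity
    from the recursion: diagonal terms cancel, since squared spins are 1, and the others obey the
    induction hypothesis. At most $N^2$ terms of weight $b / N^2$ remain, so each step gains a
    factor [b]. The initial [2 * C] bounds the two expectations separately. *)
Lemma pair_decay t k u v (f : Omega -> R) (C : R) : determined (past t) f ->
  (forall w, `|f w| <= C) -> u != v ->
  `|E (fun w => f w * (spin (k + t) u w * spin (k + t) v w)) - c * E f|
    <= b ^+ k * (2 * C).
Proof.
move=> df fC; have fin_f : finitary f by exists (past t).
have fin_ss s x y : finitary (fun w => f w * (spin s x w * spin s y w)).
  apply: (finitary_comp2 *%R fin_f).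
  exact: (finitary_comp2 *%R (@finitary_spin s x) (@finitary_spin s y)).
elim: k u v => [|k IH] u v uv.
  rewrite expr0 mul1r add0n.
  have h1 : `|E (fun w => f w * (spin t u w * spin t v w))| <= C.
    apply: (mean_bound (P := P) driver_measurable (fin_ss t u v)) => w.
    by rewrite !normrM !spin_norm !mulr1.
  have h2 : `|c * E f| <= C.
    rewrite normrM (ger0_norm pair_corr_ge0).
    apply: (le_trans _ (mean_bound (P := P) driver_measurable fin_f fC)).
    by rewrite ler_piMl// pair_corr_le1.
  apply: le_trans (ler_normB _ _) _; lra.
rewrite addSn mean_spin_pair_step//; last first.
  by apply: (determined_sub _ df); apply: sub_past; exact: leq_addl.
rewrite [X in _ - X * _](pair_corr_fixpoint uv) -mulrA mulr_suml -mulrBr.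
rewrite -sumrB normrM expr_div_n [b ^+ k.+1]exprS -[leRHS]mulrA.
have b0 := sqr_copy_gt0; have N1 := degree_ge1.
rewrite (@ger0_norm _ (b / N ^+ 2)) ?divr_ge0 ?sqr_ge0// -mulrA.
rewrite ler_pM2l// ler_pdivrMl ?exprn_gt0 ?(lt_le_trans ltr01 N1)//.
have -> : N ^+ 2 * (b ^+ k * (2 * C)) =
    \sum_(x : 'I_n | x != u) \sum_(y : 'I_n | y != v) b ^+ k * (2 * C).
  rewrite (eq_bigr (fun=> N * (b ^+ k * (2 * C)))) => [|x _].
    by rewrite sumr_const card_neq -[RHS]mulr_natl mulrA -expr2.
  by rewrite sumr_const card_neq -[LHS]mulr_natl.
apply: le_trans (ler_norm_sum _ _ _) _; apply: ler_sum => x _.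
rewrite mulr_suml -sumrB; apply: le_trans (ler_norm_sum _ _ _) _.
apply: ler_sum => y _; case: eqVneq => [<-|xy]; last exact: IH.
rewrite mul1r (_ : (fun w => _) = f); last first.
  by apply/funext => w; rewrite spin_sqr mulr1.
have C0 : 0 <= C.
  apply: le_trans (normr_ge0 (E f)) _.
  exact: (mean_bound driver_measurable fin_f fC).
rewrite subrr normr0; apply: mulr_ge0; last exact: mulr_ge0.
exact/exprn_ge0/ltW.
Qed.

(** * Decay of correlations for products of consecutive spins *)

Definition repetition_dev u i w : R :=
  spin i u w * spin i.+1 u w - (1 - eps) * c.

Lemma determined_repetition_dev u i :
  determined (past i.+1) (repetition_dev u i).
Proof.
apply: (determined_comp2 (fun x y : R => x * y - (1 - eps) * c) _
  (@determined_spin i.+1 u)).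
by apply: (determined_sub _ (@determined_spin i u)); exact: sub_past.
Qed.

Lemma finitary_repetition_dev u i : finitary (repetition_dev u i).
Proof. by exists (past i.+1); exact: determined_repetition_dev. Qed.

Lemma repetition_dev_norm u i w : `|repetition_dev u i w| <= 2.
Proof.
have h1 : `|spin i u w * spin i.+1 u w| <= 1.
  by rewrite normrM !spin_norm mulr1.
have h2 : `|(1 - eps) * c| <= 1.
  have e0 : 0 <= 1 - eps by rewrite subr_ge0 ltW.
  have c0 := pair_corr_ge0; have c1 := pair_corr_le1.
  have e2 : 1 - eps <= 1 by rewrite gerBl ltW.
  rewrite (ger0_norm (mulr_ge0 e0 c0)); exact: mulr_ile1.
apply: le_trans (ler_normB _ _) _; lra.
Qed.

(** Averaging the later spin over its new drivers replaces it by [1 - eps] times the mean of the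
    spins of the other vertices at the earlier time. What remains are pair correlations at a single
    time, controlled by [pair_decay]. *)
Lemma mean_repetition_dev_decay t k u (f : Omega -> R) (C : R) :
  determined (past t) f ->
  (forall w, `|f w| <= C) ->
  `|E (fun w => f w * repetition_dev u (k + t) w)| <= b ^+ k * (2 * C).
Proof.
move=> df fC; have fin_f : finitary f by exists (past t).
have e0 : 0 < 1 - eps by rewrite subr_gt0.
have N1 := degree_ge1; have N0 : 0 < N by rewrite (lt_le_trans ltr01).
have df' : determined (past (k + t)) f.
  by apply: (determined_sub _ df); apply: sub_past; exact: leq_addl.
have -> : E (fun w => f w * repetition_dev u (k + t) w) =
    (1 - eps) / N * \sum_(v | v != u)
      (E (fun w => f w * (spin (k + t) u w * spin (k + t) v w)) - c * E f).
  transitivity (E (fun w => f w * spin (k + t) u w * spin (k + t).+1 u w +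
      (- ((1 - eps) * c)) * f w)).
    by congr E; apply/funext => w; rewrite /repetition_dev; ring.
  rewrite (meanD driver_measurable) ?(meanZ driver_measurable)//; last 2 first.
  - apply: (finitary_comp2 *%R _ (@finitary_spin _ u)).
    exact: (finitary_comp2 *%R fin_f (@finitary_spin _ u)).
  - exact: (finitary_comp (fun x : R => - ((1 - eps) * c) * x) fin_f).
  rewrite (@mean_spin_step (past (k + t)))//; last 2 first.
  - exact: (determined_comp2 *%R df' (@determined_spin (k + t) u)).
  - exact: step_drivers_fresh.
  rewrite big_split/= sumrN sumr_const card_neq.
  rewrite (_ : c * E f *+ n.-1 = N * (c * E f)) ?mulrBr; last first.
    by rewrite mulr_natl.
  congr (_ + _); last by field; exact: degree_neq0.
  congr (_ * _); apply: eq_bigr => v _.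
  by congr E; apply/funext => w; rewrite mulrA.
rewrite normrM (@ger0_norm _ ((1 - eps) / N)) ?divr_ge0 ?(ltW e0) ?(ltW N0)//.
rewrite -mulrA.
have C0 : 0 <= b ^+ k * (2 * C).
  have C0 : 0 <= C.
    apply: le_trans (normr_ge0 (E f)) _.
    exact: (mean_bound driver_measurable fin_f fC).
  apply: mulr_ge0; last exact: mulr_ge0.
  exact/exprn_ge0/ltW/sqr_copy_gt0.
rewrite -[leRHS]mul1r; apply: ler_pM; [exact: ltW| |by rewrite gerBl ltW|].
  by rewrite mulr_ge0// invr_ge0 ltW.
rewrite ler_pdivrMl//; apply: le_trans (ler_norm_sum _ _ _) _.
have -> : N * (b ^+ k * (2 * C)) = \sum_(v : 'I_n | v != u) b ^+ k * (2 * C).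
  by rewrite sumr_const card_neq -[RHS]mulr_natl.
by apply: ler_sum => v vu; apply: pair_decay => //; rewrite eq_sym.
Qed.

(** * Second moment and concentration of the repetition statistic *)

Definition repetition_sum u m w : R :=
  \sum_(1 <= i < m.+1) repetition_dev u i w.

Lemma finitary_repetition_sum u m : finitary (repetition_sum u m).
Proof. by apply: finitary_sum => i _; exact: finitary_repetition_dev. Qed.

Lemma geometric_sum_le m : \sum_(1 <= i < m.+1) b ^+ (m - i) <= (1 - b)^-1.
Proof.
have b1 : 0 < 1 - b by rewrite subr_gt0 sqr_copy_lt1.
rewrite -[leRHS]mul1r ler_pdivlMr//.
elim: m => [|m IH]; first by rewrite big_geq// mul0r.
rewrite big_nat_recr//= subnn expr0.
rewrite (eq_big_nat _ _ (F2 := fun i => b * b ^+ (m - i))); last first.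
  by move=> i /andP[_ im]; rewrite subSn// exprS.
rewrite -mulr_sumr mulrDl mul1r -mulrA -lerBrDr opprB addrCA subrr addr0.
by rewrite -[leRHS]mulr1 ler_wpM2l// ltW// sqr_copy_gt0.
Qed.

(** The second moment is taken about the limiting mean, so the bias at finite times is covered as
    well. Expanding the square, each new term adds at most 4 from its own square and twice
    [4 / (1 - b)] from the cross terms, a geometric series. *)
Lemma repetition_sum_variance u m :
  E (fun w => repetition_sum u m w ^+ 2) <= m%:R * (4 + 8 / (1 - b)).
Proof.
elim: m => [|m IH].
  rewrite mul0r (_ : (fun w => _) = fun=> 0) ?mean_cst//.
  by apply/funext => w; rewrite /repetition_sum big_geq// expr0n.
have fin_S := @finitary_repetition_sum u m.
have fin_Y := @finitary_repetition_dev u m.+1.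
have fin_SY := finitary_comp2 *%R fin_S fin_Y.
have -> : E (fun w => repetition_sum u m.+1 w ^+ 2) =
    E (fun w => repetition_sum u m w ^+ 2) +
    2 * E (fun w => repetition_sum u m w * repetition_dev u m.+1 w) +
    E (fun w => repetition_dev u m.+1 w ^+ 2).
  have fin_S2 := finitary_comp (fun x : R => x ^+ 2) fin_S.
  have fin_2SY := finitary_comp (fun x : R => 2 * x) fin_SY.
  have fin_Y2 := finitary_comp (fun x : R => x ^+ 2) fin_Y.
  have fin_sum := finitary_comp2 +%R fin_S2 fin_2SY.
  rewrite -(meanZ driver_measurable _ fin_SY).
  rewrite -(meanD driver_measurable fin_S2 fin_2SY).
  rewrite -(meanD driver_measurable fin_sum fin_Y2).
  congr E; apply/funext => w.
  by rewrite /repetition_sum big_nat_recr//=; ring.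
have cross : E (fun w => repetition_sum u m w * repetition_dev u m.+1 w) <=
    4 / (1 - b).
  apply: le_trans (ler_norm _) _.
  have -> : E (fun w => repetition_sum u m w * repetition_dev u m.+1 w) =
      \sum_(1 <= i < m.+1)
        E (fun w => repetition_dev u i w * repetition_dev u m.+1 w).
    rewrite -(mean_sum driver_measurable).
      by congr E; apply/funext => w; rewrite mulr_suml.
    move=> i _.
    exact: (finitary_comp2 *%R (@finitary_repetition_dev u i) fin_Y).
  apply: le_trans (ler_norm_sum _ _ _) _.
  apply: (@le_trans _ _ (4 * \sum_(1 <= i < m.+1) b ^+ (m - i))); last first.
    by rewrite ler_pM2l// geometric_sum_le.
  rewrite mulr_sumr; apply: ler_sum_nat => i /andP[_ im].
  (* The deviation at [i] also involves time [i.+1], so the past ends there and only [m - i] steps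
     contribute to the decay; its bound 2 gives the constant [2 * 2]. *)
  have -> : m.+1 = ((m - i) + i.+1)%N by rewrite addnS subnK.
  rewrite [leRHS]mulrC (_ : 4 = 2 * 2 :> R); last by rewrite -natrM.
  apply: mean_repetition_dev_decay; first exact: determined_repetition_dev.
  exact: repetition_dev_norm.
have diag : E (fun w => repetition_dev u m.+1 w ^+ 2) <= 4.
  rewrite -(mean_cst (P := P) 4).
  apply: (mean_le driver_measurable) => [||w]; [|exact: finitary_cst|].
    exact: (finitary_comp (fun x : R => x ^+ 2) fin_Y).
  rewrite -real_normK ?num_real// (_ : 4 = 2 ^+ 2 :> R) ?lerXn2r ?nnegrE//.
    exact: repetition_dev_norm.
  by rewrite -natrX.
rewrite -natr1 mulrDl mul1r.
have e8 : 8 / (1 - b) = 2 * (4 / (1 - b)) by rewrite mulrA -natrM.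
rewrite e8 in IH *.
lra.
Qed.

Lemma chebyshev_finitary (f : Omega -> R) (e : R) : finitary f -> 0 < e ->
  fine (P [set w | e <= `|f w|]) <= E (fun w => f w ^+ 2) / e ^+ 2.
Proof.
move=> ff e0.
have fin_A : finitary (fun w => e <= `|f w|).
  exact: (finitary_comp (fun x : R => e <= `|x|) ff).
rewrite -mean_indic; last exact: (finitary_measurable_pred driver_measurable).
rewrite ler_pdivlMr ?exprn_gt0// mulrC.
have fin_I : finitary (\1_[set w | e <= `|f w|] : Omega -> R).
  have := finitary_comp (fun x : bool => x%:R : R) fin_A.
  congr finitary; apply/funext => w; rewrite indicE; congr (_%:R).
  by rewrite mem_setE.
rewrite -(meanZ driver_measurable)//.
apply: (mean_le driver_measurable).
- exact: (finitary_comp (fun x : R => e ^+ 2 * x) fin_I).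
- exact: (finitary_comp (fun x : R => x ^+ 2) ff).
- move=> w; have -> : \1_[set x | (e <= `|f x|)%R] w = (e <= `|f w|)%R%:R :> R.
    by rewrite indicE mem_setE.
  have [ef|_] := boolP (e <= `|f w|).
    rewrite mulr1 -(real_normK (num_real (f w))).
    by apply: lerXn2r => //; rewrite nnegrE ltW.
  by rewrite mulr0 sqr_ge0.
Qed.

(** The indicator that two opinions agree is half of 1 plus the product of their spins. *)
Lemma repetition_statisticE u t w : (1 < t)%N ->
  repetition_statistic R 1 (fun i : 'I_t.+1 => opinion M i u w) -
    (1 + (1 - eps) * c) / 2 = repetition_sum u t.-1 w / (2 * t.-1%:R).
Proof.
move=> t1; rewrite /repetition_statistic subn1.
have m0 : t.-1%:R != 0 :> R by rewrite pnatr_eq0 -lt0n -ltnS prednK// ltnW.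
have -> : \sum_(1 <= i < t.-1.+1)
    (opinion M (@inord t i) u w == opinion M (@inord t (i + 1)) u w)%:R =
    \sum_(1 <= i < t.-1.+1)
      (2^-1 * repetition_dev u i w + (1 + (1 - eps) * c) / 2) :> R.
  apply: eq_big_nat => i /andP[_ it].
  (* Now [i < t], so [i] and [i + 1] are both at most [t] and [inord] returns them rather than its
     default value. *)
  rewrite prednK ?(ltnW t1)// in it.
  rewrite !inordK ?addn1//; last exact: ltnW.
  rewrite /repetition_dev /spin.
  have := opinion_le1 i u w; have := opinion_le1 i.+1 u w.
  by case: (opinion M i u w) => [|[|//]]; case: (opinion M i.+1 u w) => [|[|//]]
    _ _ /=; field.
rewrite big_split/= -mulr_sumr -/(repetition_sum u t.-1 w).
rewrite sumr_const_nat subn1 /= -mulr_natl.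
by field.
Qed.

Lemma finitary_repetition_statistic u t : finitary (fun w =>
  repetition_statistic R 1 (fun i : 'I_t.+1 => opinion M i u w)).
Proof.
apply: (finitary_comp (fun x : R => (t - 1)%:R^-1 * x)).
apply: finitary_sum => i _.
exact: (finitary_comp2 (fun x y : nat => (x == y)%:R : R)
  (@finitary_opinion _ u) (@finitary_opinion _ u)).
Qed.

(** Chebyshev's inequality for the sum of $t - 1$ deviations at the level $2 (t - 1) e$: the second
    moment is linear in $t - 1$ and the squared level quadratic, which leaves $1 / (t - 1)$. *)
Lemma repetition_statistic_concentration u (e : R) t : 0 < e -> (1 < t)%N ->
  fine (P [set w | e <= `|repetition_statistic R 1
      (fun i : 'I_t.+1 => opinion M i u w) - (1 + (1 - eps) * c) / 2|]) <=
  (4 + 8 / (1 - b)) / (4 * e ^+ 2) * t.-1%:R^-1.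
Proof.
move=> e0 t1.
have m0 : 0 < t.-1%:R :> R by rewrite ltr0n -ltnS prednK// ltnW.
have -> : [set w | e <= `|repetition_statistic R 1
      (fun i : 'I_t.+1 => opinion M i u w) - (1 + (1 - eps) * c) / 2|] =
    [set w | e * (2 * t.-1%:R) <= `|repetition_sum u t.-1 w|].
  have m2 : 0 < 2 * t.-1%:R :> R by rewrite mulr_gt0.
  apply/seteqP; split => w /=; rewrite repetition_statisticE// normf_div;
    by rewrite (gtr0_norm m2) ler_pdivlMr.
have h0 : 0 < e * (2 * t.-1%:R) by rewrite !mulr_gt0.
apply: le_trans (chebyshev_finitary (@finitary_repetition_sum u t.-1) h0) _.
rewrite ler_pdivrMr ?exprn_gt0//.
apply: le_trans (repetition_sum_variance _ _) _.
rewrite le_eqVlt; apply/orP; left; apply/eqP.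
have b1 : 1 - b != 0 by rewrite gt_eqF// subr_gt0 sqr_copy_lt1.
by field; rewrite b1 (gt_eqF e0) (gt_eqF m0).
Qed.

End noisy_voter_complete.

(** With $x = n_1 - 2$ and $y = n_2 - 2$, cross-multiplication gives $b (1 - b) (x - y) (1 - x y) =
    0$, which treats the case $N = 1$, where the correlation vanishes, along with the others. For
    natural numbers $x y = 1$ forces $x = y = 1$. *)
Lemma pair_corr_inj (R : realType) (eps : R) (n1 n2 : nat) :
  0 < eps -> eps < 1 -> (2 <= n1)%N -> (2 <= n2)%N ->
  pair_corr eps n1 = pair_corr eps n2 -> n1 = n2.
Proof.
move=> e0 e1; case: n1 => [|[|k1]]//; case: n2 => [|[|k2]]// _ _.
have b0 := sqr_copy_gt0 e1; have b1 := sqr_copy_lt1 e0 e1.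
have N1 := @pair_corr_den_gt0 R eps k1.+2 isT e0 e1.
have N2 := @pair_corr_den_gt0 R eps k2.+2 isT e0 e1.
move/eqP; rewrite eqr_div ?(lt0r_neq0 N1) ?(lt0r_neq0 N2)// => /eqP.
rewrite /= -!natr1 !addrK; move: b0 b1; clear.
move: ((1 - eps) ^+ 2) => b b0 b1.
set x : R := k1%:R; set y : R := k2%:R => h.
have /eqP : b * (1 - b) * ((x - y) * (1 - x * y)) = 0.
  by move/eqP: h; rewrite -subr_eq0 => /eqP <-; ring.
rewrite !mulf_eq0 (gt_eqF b0) subr_eq0 (gt_eqF b1)/= !subr_eq0.
rewrite /x /y; case/orP; first by rewrite eqr_nat => /eqP ->.
rewrite eq_sym -natrM pnatr_eq1 muln_eq1 => /andP[/eqP-> /eqP->].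
by [].
Qed.

(** * Tail events of the two statistics and the separation of their limits *)

Section tail_events.
Local Open Scope classical_set_scope.

(** A union bound on the two bad events, hence valid for every coupling of the two processes. *)
Lemma probability_setI_near1 (R : realType) (d : measure_display)
    (Omega : measurableType d) (P : probability Omega R) (A B : set Omega) :
  measurable A -> measurable B ->
  1 - fine (P A) - fine (P B) <= fine (P (~` A `&` ~` B)).
Proof.
move=> mA mB; have mU : measurable (A `|` B) by exact: measurableU.
rewrite -setCU probability_setC// fineB ?fin_num_measure//=.
have : (P (A `|` B) <= P A + P B)%E by exact: measureU2.
rewrite -[P (A `|` B)]fineK ?fin_num_measure//.
rewrite -[P A]fineK ?fin_num_measure// -[P B]fineK ?fin_num_measure//.
rewrite -EFinD lee_fin /=; lra.
Qed.

Lemma inv_predn_cvg0 (R : realType) (K : R) :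
  K * t.-1%:R^-1 @[t --> \oo] --> 0.
Proof.
rewrite -[X in _ --> X](mulr0 K); apply: cvgMr => //=.
(* The first shift removes the predecessor; the second reaches the harmonic sequence, whose terms
   are $1 / (t + 1)$. *)
rewrite -(cvg_shiftS (fun t => t.-1%:R^-1 : R)) /=.
rewrite -(cvg_shiftS (fun t => t%:R^-1 : R)) /=.
exact: cvg_harmonic.
Qed.

Lemma measurable_repetition_tail (R : realType) (eps : R) (n : nat)
    (hn : (2 <= n)%N) (d : measure_display) (Omega : measurableType d)
    (P : probability Omega R) (M : nvm eps (complete_graph hn) P)
    (u : complete_graph hn) (t : nat) (e m : R) :
  measurable [set w | e <= `|repetition_statistic R 1
    (fun i : 'I_t.+1 => opinion M i u w) - m|].
Proof.
exact: (finitary_measurable_pred (driver_measurable M)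
  (finitary_comp (fun x : R => e <= `|x - m|)
    (finitary_repetition_statistic M u t))).
Qed.

End tail_events.

Theorem theorem1p1 (R : realType) (eps : R) (heps0 : 0 < eps) (heps1 : eps < 1)
    (n1 n2 : nat) (hn1 : (2 <= n1)%N) (hn2 : (2 <= n2)%N) (hn : n1 <> n2)
    (u1 : complete_graph hn1) (u2 : complete_graph hn2) :
  distinguishable eps u1 u2 (@repetition_statistic R 1) \/
  distinguishable eps u1 u2 (@repetition_statistic R 2).
Proof.
(* [m n] is the limit of $S^{(1)}$ on the complete graph with [n] vertices. *)
left; pose m n : R := (1 + (1 - eps) * pair_corr eps n) / 2.
have m12 : m n1 != m n2.
  apply/eqP => h; apply: hn; apply: (pair_corr_inj heps0 heps1 hn1 hn2).
  have /eqP : (1 - eps) * (pair_corr eps n1 - pair_corr eps n2) = 0.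
    by rewrite /m in h; lra.
  by rewrite mulf_eq0 !subr_eq0 (gt_eqF heps1)/= => /eqP.
(* Half the distance between the limits: the open intervals of this radius around them are
   disjoint. *)
pose e : R := `|m n1 - m n2| / 2.
have e0 : 0 < e by rewrite divr_gt0// normr_gt0 subr_eq0.
exists (fun=> [set x | `|x - m n1| < e]%classic).
exists (fun=> [set x | `|x - m n2| < e]%classic).
split=> [_|d Omega P M1 M2].
  rewrite -subset0 => x /= [h1 h2].
  have : `|m n1 - m n2| < e + e.
    rewrite (_ : m n1 - m n2 = (x - m n2) - (x - m n1)); last by ring.
    by apply: le_lt_trans (ler_normB _ _) _; rewrite addrC ltrD.
  by rewrite /e -splitr ltxx.
pose S n (hn : (2 <= n)%N) (M : nvm eps (complete_graph hn) P) u t w :=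
  repetition_statistic R 1 (fun i : 'I_t.+1 => opinion M i u w).
pose B n (hn : (2 <= n)%N) (M : nvm eps (complete_graph hn) P) u t :=
  [set w | e <= `|S n hn M u t w - m n|]%classic.
have mB n (hn' : (2 <= n)%N) M u t : measurable (B n hn' M u t).
  exact: measurable_repetition_tail.
have BC n (hn' : (2 <= n)%N) M u t :
    (~` B n hn' M u t = [set w | `|S n hn' M u t w - m n| < e])%classic.
  by apply/seteqP; split => w /=; rewrite ltNge => /negP.
set G := (X in (X @ \oo --> _)%classic).
have GE t : G t = P (~` B _ _ M1 u1 t `&` ~` B _ _ M2 u2 t)%classic.
  by rewrite /G !BC.
have mG t : measurable (~` B _ _ M1 u1 t `&` ~` B _ _ M2 u2 t)%classic.
  by apply: measurableI; exact: measurableC.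
have -> : G = EFin \o (fun t => fine (G t)).
  by apply/funext => t /=; rewrite fineK// GE fin_num_measure.
apply: cvg_EFin; first by near=> t.
(* The constant of the concentration bound at radius [e], the same for both graphs; the joint
   probability is squeezed between [1 - 2 K / (t - 1)] and 1. *)
pose K := (4 + 8 / (1 - (1 - eps) ^+ 2)) / (4 * e ^+ 2).
have lowK :
    (1 - K * t.-1%:R^-1 - K * t.-1%:R^-1 @[t --> \oo] --> (1 : R))%classic.
  rewrite -[X in (_ --> X)%classic]subr0 -[X in (_ --> X - _)%classic]subr0.
  by apply: cvgB; [apply: cvgB; [exact: cvg_cst|]|]; exact: inv_predn_cvg0.
apply: (squeeze_cvgr _ lowK (cvg_cst _)).
near=> t; have t1 : (1 < t)%N by near: t; exact: nbhs_infty_gt.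
rewrite /= GE; apply/andP; split; last first.
  by rewrite -lee_fin fineK ?fin_num_measure// probability_le1.
have := probability_setI_near1 P (mB _ _ M1 u1 t) (mB _ _ M2 u2 t).
have := repetition_statistic_concentration M1 heps0 heps1 u1 e0 t1.
have := repetition_statistic_concentration M2 heps0 heps1 u2 e0 t1.
rewrite -/K -/(m n1) -/(m n2) -/(B _ _ M1 u1 t) -/(B _ _ M2 u2 t); lra.
Unshelve. all: by end_near.
Qed.
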